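(* Let $V=A\oplus B$ be a non-trivial splitting of a finite-dimensional complex vector space. Let $X\subset\mathbb{P}V$ and $Y\subset\mathbb{P}A$ be projective varieties, and let $\pi_B$ denote the projection $V\to A$ with kernel $B$ (and the induced rational map $\mathbb{P}V\dashrightarrow\mathbb{P}A$). Suppose that the following tangency condition holds: for each smooth point $[y]\in Y$ there is a smooth point $[x]\in X$ such that $\pi_B(\widehat T_xX)\subset\widehat T_yY$. Then $$Y^\vee\subseteq X^\vee\cap\mathbb{P}A^*.$$ Moreover, if $X^\vee$ and $Y^\vee$ are hypersurfaces defined respectively by polynomials $\Delta_X$ and $\Delta_Y$, and if for every general point $[h]\in Y^\vee$ the hyperplane $\mathcal{V}(h)$, viewed as a hyperplane in $\mathbb{P}V$ (that is, the point $[h]\in\mathbb{P}A^*\subset\mathbb{P}V^*$), is a point of multiplicity $m$ of $X^\vee$, then $$\Delta_Y^m \mid \operatorname{Res}(\Delta_X,A^* ).$$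
   Context: The splitting $V=A\oplus B$ (both summands non-zero) induces $V^*=A^*\oplus B^*$, where a functional on $A$ is extended to $V$ by zero on $B$; so $\mathbb{P}A^*\subset\mathbb{P}V^*$. For a projective variety $X\subset\mathbb{P}V$, $\widehat X\subset V$ is the affine cone and $\widehat T_xX\subset V$ is the tangent space to $\widehat X$ at a point $x\in\widehat X$. The projective dual variety $X^\vee\subset\mathbb{P}V^*$ is the Zariski closure of the set of $[H]\in\mathbb{P}V^*$ such that the hyperplane $H$ contains $\widehat T_xX$ for some smooth point $[x]\in X$; similarly $Y^\vee\subset\mathbb{P}A^*$. When $X^\vee$ is a hypersurface, $\Delta_X$ denotes its (reduced, homogeneous) defining polynomial, unique up to scale. For $\Delta\in S^dV$ (a homogeneous polynomial on $V^*$), $\operatorname{Res}(\Delta,A^* )\in S^dA$ denotes the restriction of $\Delta$ to the subspace $A^*\subset V^*$. *)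

(* Defs.v *)
(* Projective varieties over an algebraically closed field of characteristic 0.
   A variety is a Zariski closed subset of a projective space, not necessarily
   irreducible. *)
From HB Require Import structures.
From mathcomp Require Import all_boot all_order all_algebra.
From mathcomp Require Import complex mpoly.
From mathcomp Require Import boolp classical_sets reals.

Set Implicit Arguments.
Unset Strict Implicit.
Unset Printing Implicit Defensive.

Import GRing.Theory.
Local Open Scope ring_scope.

(* The polynomials on W (the symmetric algebra of its dual), written in the
   coordinates of the basis [vbasis {:W}]. *)
Notation polyOn K W := {mpoly K[\dim {: W}]}.

Section Polynomials.
Variable K : numClosedFieldType.

Definition crd (W : vectType K) (w : W) : 'I_(\dim {:W}) -> K :=
  fun i => coord (vbasis {:W}) i w.

Definition peval (W : vectType K) (p : polyOn K W) (w : W) : K := p.@[crd w].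

(* The differential of p at x, applied to v. *)
Definition pdiff (W : vectType K) (p : polyOn K W) (x v : W) : K :=
  \sum_i crd v i * peval (p^`M(i))%MM x.

(* The polynomial p \o f on U, for f linear. *)
Definition pullback (U W : vectType K) (f : 'Hom(U, W)) (p : polyOn K W) :
    polyOn K U :=
  comp_mpoly
    [tuple \sum_(j < \dim {:U}) crd (f (vbasis {:U})`_j) i *: 'X_j
       | i < \dim {:W}] p.

Definition pdvd n (q p : {mpoly K[n]}) := exists r, p = r * q.

Definition squarefree n (p : {mpoly K[n]}) :=
  p <> 0 /\ forall q, pdvd (q ^+ 2) p -> exists c : K, q = c%:MP.

(* m is the order of vanishing of p at w. *)
Definition mult_at (W : vectType K) (p : polyOn K W) (w : W) (m : nat) :=
  (forall k : 'X_{1..\dim {:W}}, (mdeg k < m)%N -> peval (p^`M[k]) w = 0) /\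
  (exists2 k : 'X_{1..\dim {:W}}, mdeg k = m & peval (p^`M[k]) w <> 0).

End Polynomials.

Section Projective.
Variable K : numClosedFieldType.
Local Open Scope classical_set_scope.

(* The projective space of lines in W. *)
Definition proj (W : vectType K) := {l : {vspace W} | \dim l == 1%N}.

Definition line (W : vectType K) (l : proj W) : {vspace W} := sval l.

Definition homogeneous n (p : {mpoly K[n]}) := exists d, p \is d.-homog.

Definition zero_locus (W : vectType K) (F : set (polyOn K W)) : set (proj W) :=
  [set l : proj W | forall p, F p -> forall w, w \in line l -> peval p w = 0].

Definition zclosed (W : vectType K) (Z : set (proj W)) :=
  exists2 F : set (polyOn K W),
    (forall p, F p -> homogeneous p) & Z = zero_locus F.

Definition zclosure (W : vectType K) (S : set (proj W)) : set (proj W) :=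
  smallest (@zclosed W) S.

Definition zopen (W : vectType K) (Z : set (proj W)) := zclosed (~` Z).

Definition zirreducible (W : vectType K) (Z : set (proj W)) :=
  [/\ zclosed Z, Z !=set0 &
      forall Z1 Z2, zclosed Z1 -> zclosed Z2 ->
        Z = Z1 `|` Z2 -> Z = Z1 \/ Z = Z2].

(* P holds at the general point of Z: on a dense open subset of Z. *)
Definition general_point (W : vectType K) (Z : set (proj W))
    (P : proj W -> Prop) :=
  exists U : set (proj W),
    [/\ zopen U, Z `<=` zclosure (Z `&` U) & forall l, (Z `&` U) l -> P l].

Definition vanishing_ideal (W : vectType K) (X : set (proj W)) :
    set (polyOn K W) :=
  [set p | forall l, X l -> forall w, w \in line l -> peval p w = 0].

(* The tangent space to the affine cone over X at a nonzero point x of the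
   line l; it does not depend on the choice of x. *)
Definition tangent (W : vectType K) (X : set (proj W)) (l : proj W) : set W :=
  [set v | forall x, x \in line l -> x != 0 ->
             forall p, vanishing_ideal X p -> pdiff p x v = 0].

Definition has_dim (W : vectType K) (S : set W) (d : nat) :=
  exists2 U : {vspace W}, S = [set v | v \in U] & \dim U = d.

Definition irr_chain (W : vectType K) (X : set (proj W)) (l : proj W)
    (d : nat) (Z : nat -> set (proj W)) :=
  (forall i, (i <= d)%N -> [/\ zirreducible (Z i), Z i l & Z i `<=` X]) /\
  (forall i, (i < d)%N -> Z i `<` Z i.+1).

(* The Krull dimension of the local ring of X at l is d. *)
Definition local_dim (W : vectType K) (X : set (proj W)) (l : proj W)
    (d : nat) :=
  (exists Z, irr_chain X l d Z) /\ ~ (exists Z, irr_chain X l d.+1 Z).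

(* The tangent space to X at l is the quotient by the line l of the tangent
   space to the cone, whence the successor. *)
Definition smooth_point (W : vectType K) (X : set (proj W)) (l : proj W) :=
  X l /\ exists2 d, local_dim X l d & has_dim (tangent X l) d.+1.

(* Z is a hypersurface, with reduced homogeneous equation p. The nonemptiness
   only matters in P^0, where the empty set is the zero locus of a nonconstant
   form. *)
Definition hypersurface_eq (W : vectType K) (Z : set (proj W)) (p : polyOn K W) :=
  [/\ Z !=set0, squarefree p, exists2 d, (0 < d)%N & p \is d.-homog &
      Z = zero_locus [set p]].

(* When p is the reduced equation of a hypersurface, this says that l is a
   point of multiplicity m of that hypersurface. *)
Definition multiplicity (W : vectType K) (p : polyOn K W) (l : proj W) (m : nat) :=
  forall w, w \in line l -> w != 0 -> mult_at p w m.

(* The image under the rational map induced by f, which is undefined at the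
   lines contained in the kernel of f. *)
Definition proj_image (U W : vectType K) (f : 'Hom(U, W)) (Z : set (proj U)) :
    set (proj W) :=
  [set l | exists2 l', Z l' & line l = (f @: line l')%VS].

Definition dual (W : vectType K) : vectType K := 'Hom(W, K^o).

Definition dual_variety (W : vectType K) (X : set (proj W)) :
    set (proj (dual W)) :=
  zclosure [set H : proj (dual W) | exists2 l, smooth_point X l &
    forall h : 'Hom(W, K^o), h \in line H ->
      forall v, tangent X l v -> h v = 0].

End Projective.

Section Splitting.
Variables (K : numClosedFieldType) (V : vectType K) (A B : {vspace V}).

(* The projection of V onto A along B (for V the direct sum of A and B). *)
Definition proj_along : 'Hom(V, subvs_of A) :=
  (linfun (vsproj A) \o daddv_pi A B)%VF.

(* The extension by zero on B of a functional on A. *)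
Definition dual_ext : 'Hom(dual (subvs_of A), dual V) :=
  linfun (fun h : 'Hom(subvs_of A, K^o) => (h \o proj_along)%VF).

(* The subspace P(A^* ) of P(V^* ). *)
Definition PAdual : set (proj (dual V)) := proj_image dual_ext setT.

Definition Res (p : polyOn K (dual V)) : polyOn K (dual (subvs_of A)) :=
  pullback dual_ext p.

End Splitting.

Section Facts.
Variable K : numClosedFieldType.

Lemma peval_pullback (U W : vectType K) (f : 'Hom(U, W)) (p : polyOn K W) u :
  peval (pullback f p) u = peval p (f u).
Proof.
rewrite /peval /pullback comp_mpoly_meval; apply: meval_eq => i.
rewrite tnth_mktuple raddf_sum /=.
rewrite {2}(coord_vbasis (memvf u)) linear_sum /crd linear_sum.
by apply: eq_bigr => j _; rewrite mevalZ mevalXU !linearZ /= mulrC.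
Qed.

Section Direct.
Variables (V : vectType K) (A B : {vspace V}).

Lemma dual_extE (h : dual (subvs_of A)) :
  dual_ext A B h = ((h : 'Hom(_, _)) \o proj_along A B)%VF.
Proof.
pose g (h : 'Hom(subvs_of A, K^o)) : 'Hom(V, K^o) := (h \o proj_along A B)%VF.
have gP : linear g.
  by move=> a u v; rewrite /g comp_lfunDl comp_lfunZl.
pose gL := GRing.isLinear.Build _ _ _ _ g gP.
pose G : {linear _ -> _} := HB.pack g gL.
exact: (lfunE G h).
Qed.

Hypothesis dirAB : (A :&: B = 0)%VS.

Lemma proj_along_l a : a \in A -> vsval (proj_along A B a) = a.
Proof.
by move=> aA; rewrite /proj_along comp_lfunE lfunE /= daddv_pi_id // vsprojK.
Qed.

Lemma proj_along_r b : b \in B -> proj_along A B b = 0.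
Proof.
move=> bB; rewrite /proj_along comp_lfunE lfunE /=.
have e := daddv_pi_add dirAB (subvP (addvSr A B) _ bB).
have BA : (B :&: A = 0)%VS by rewrite capvC.
move: e; rewrite (daddv_pi_id BA bB) => /(canRL (addrK _)); rewrite subrr => ->.
exact: linear0.
Qed.

Lemma dual_ext_inj : lker (dual_ext A B) = 0%VS.
Proof.
apply/eqP/lker0P => h1 h2; rewrite !dual_extE => /lfunP e.
apply/lfunP => a; move: (e (vsval a)).
have pa : proj_along A B (vsval a) = a.
  by apply: val_inj; apply: proj_along_l; apply: subvsP.
by rewrite comp_lfunE [RHS]comp_lfunE pa.
Qed.

(* Every point of P(A^* ) does have an image in P(V^* ). *)
Lemma proj_image_dual_ext (l : proj (dual (subvs_of A))) :
  exists l', proj_image (dual_ext A B) [set l]%classic l'.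
Proof.
have d : \dim (dual_ext A B @: line l)%VS == 1%N.
  by rewrite limg_dim_eq ?(eqP (valP l)) // dual_ext_inj capv0.
by exists (exist (fun L : {vspace dual V} => \dim L == 1%N) _ d); exists l.
Qed.

End Direct.
End Facts.

(* Main.v *)
(* The first assertion holds because h o pi_B kills the tangent space of X at x
   as soon as h kills the tangent space of Y at y, and pulling back along the
   inclusion A^* -> V^* preserves closed sets.

   For the second one, the derivatives of Delta_X of order less than m vanish on
   a dense subset of Y^v, hence on Y^v. So, on every line, the restriction of
   f = Res(Delta_X, A^* ) vanishes to order m at each root of q = Delta_Y. As q
   is squarefree, its restriction to a general line x + tu has simple roots, and
   is therefore divisible by its m-th power there. When the leading coefficient
   in t of q(x + tu) is constant, q^m divides f as soon as this holds on the
   general line of direction u: in K[x][t], the remainder of f(x + tu) by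
   q(x + tu)^m vanishes for general x, hence is zero, and it remains to set
   t = 0. The same principle reduces Gauss's lemma over K[x], needed for the
   simplicity of the roots, to the one-variable case, so that no factorization
   in K[x] is used. *)
From HB Require Import structures.
Require Import Defs.
From mathcomp Require Import all_boot all_order all_algebra separable.
From mathcomp Require Import complex mpoly.
From mathcomp Require Import boolp classical_sets reals.

Set Implicit Arguments.
Unset Strict Implicit.
Unset Printing Implicit Defensive.

Import GRing.Theory Num.Theory.
Local Open Scope ring_scope.

(** * Restriction to lines *)

(* The restriction t |-> p (x + t u), with the coordinates of x left generic
   in [gline] and specialized in [line_at]. *)
HB.lock Definition gline (K : numClosedFieldType) (n : nat) (u : 'I_n -> K) :
    {mpoly K[n]} -> {poly {mpoly K[n]}} :=
  mmap (polyC \o @mpolyC n K) (fun i => ('X_i)%:P + (u i)%:MP *: 'X).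

Section Lines.
Variables (K : numClosedFieldType) (n : nat).
Implicit Types (p q f D : {mpoly K[n]}) (u x : 'I_n -> K).

Lemma mpoly_rmorph_ext (S : pzRingType) (g h : {rmorphism {mpoly K[n]} -> S}) :
  (forall c, g c%:MP = h c%:MP) -> (forall i, g 'X_i = h 'X_i) -> g =1 h.
Proof.
move=> eC eX p; rewrite (mpolyE p) !rmorph_sum; apply: eq_bigr => m _.
rewrite -mul_mpolyC !rmorphM eC mpolyXE_id !rmorph_prod; congr (_ * _).
by apply: eq_bigr => i _; rewrite !rmorphXn /= eX.
Qed.

Fact gline_is_additive u : additive (@gline K n u).
Proof. by rewrite gline.unlock => p q; apply: raddfB. Qed.

Fact gline_is_multiplicative u : multiplicative (@gline K n u).
Proof.
by rewrite gline.unlock; split=> [p q|]; [apply: rmorphM|apply: rmorph1].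
Qed.

HB.instance Definition _ u := GRing.isAdditive.Build {mpoly K[n]}
  {poly {mpoly K[n]}} (@gline K n u) (@gline_is_additive u).
HB.instance Definition _ u := GRing.isMultiplicative.Build {mpoly K[n]}
  {poly {mpoly K[n]}} (@gline K n u) (@gline_is_multiplicative u).

Definition line_at u x p : {poly K} := map_poly (meval x) (gline u p).

HB.instance Definition _ u x := GRing.RMorphism.copy (line_at u x)
  (map_poly (meval x) \o gline u).

Lemma glineC u c : gline u c%:MP = c%:MP%:P.
Proof. by rewrite gline.unlock; apply: mmapC. Qed.

Lemma glineD u : {morph gline u : p q / p + q}.
Proof. exact: rmorphD. Qed.

Lemma glineM u : {morph gline u : p q / p * q}.
Proof. exact: rmorphM. Qed.

Lemma glineX u i : gline u 'X_i = ('X_i)%:P + (u i)%:MP *: 'X.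
Proof. by rewrite gline.unlock mmapX mmap1U. Qed.

Lemma gline_at0 u p : (gline u p).[0] = p.
Proof.
rewrite -[LHS]/((horner_eval 0 \o gline u) p) -[RHS]/(idfun p).
apply: mpoly_rmorph_ext => [c|i] /=; rewrite /horner_eval.
  by rewrite glineC hornerC.
by rewrite glineX hornerD hornerC hornerZ hornerX mulr0 addr0.
Qed.

Lemma line_atC u x c : line_at u x c%:MP = c%:P.
Proof. by rewrite /line_at glineC map_polyC; congr polyC; apply: mevalC. Qed.

Lemma line_atX u x i : line_at u x 'X_i = (x i)%:P + u i *: 'X.
Proof.
rewrite /line_at glineX rmorphD /= map_polyC -mul_polyC rmorphM /=.
rewrite map_polyC map_polyX -mul_polyC; congr (_%:P + _%:P * _).
  exact: mevalXU.
exact: mevalC.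
Qed.

Lemma horner_line_at u x p t : (line_at u x p).[t] = p.@[fun i => x i + t * u i].
Proof.
rewrite -[LHS]/((horner_eval t \o line_at u x) p).
apply: mpoly_rmorph_ext => [c|i]; rewrite /= /horner_eval.
  by rewrite line_atC hornerC [RHS]mevalC.
by rewrite line_atX [RHS]mevalXU !hornerE mulrC.
Qed.

Lemma polyfun0 (P : {poly K}) : (forall t, P.[t] = 0) -> P = 0.
Proof.
(* In characteristic 0 the integers below [size P] are distinct, which is one root too many. *)
move=> P0; apply: (@roots_geq_poly_eq0 _ P [seq i%:R | i <- iota 0 (size P)]).
- by apply/allP => _ /mapP[i _ ->]; apply/eqP.
- by rewrite map_inj_uniq ?iota_uniq //; apply: (mulrIn (oner_neq0 K)).
- by rewrite size_map size_iota.
Qed.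

(** The chain rule. As differentiation is no ring morphism, it is propagated on generic lines from
    constants and variables through products and sums. *)
Lemma deriv_line_at u x p :
  (line_at u x p)^`() = line_at u x (\sum_i u i *: p^`M(i)).
Proof.
suff H : (gline u p)^`() = gline u (\sum_i u i *: p^`M(i)).
  by rewrite /line_at deriv_map H.
pose T p := (gline u p)^`() = gline u (\sum_i u i *: p^`M(i)).
have TC c : T c%:MP.
  rewrite /T glineC derivC big1 ?rmorph0 // => i _.
  by rewrite mderivC scaler0.
have TX i : T 'X_i.
  rewrite /T glineX derivD derivC add0r derivZ derivX.
  rewrite (bigD1 i) //= big1 ?addr0 => [|j ji].
    rewrite mderivX mnm1E eqxx scale1r.
    rewrite (_ : (U_(i) - U_(i))%MM = 0%MM) ?mpolyX0; last first.
      by apply/mnmP => j; rewrite mnmBE subnn mnm0E.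
    by rewrite -mul_mpolyC mulr1 glineC -mul_polyC mulr1.
  by rewrite mderivX mnm1E eq_sym (negbTE ji) scale0r scaler0.
have TM p1 p2 : T p1 -> T p2 -> T (p1 * p2).
  rewrite /T glineM derivM => -> ->; rewrite -!glineM -glineD.
  congr (gline u _); rewrite mulr_suml mulr_sumr -big_split.
  by apply: eq_bigr => i _; rewrite mderivM scalerDr -scalerAl -scalerAr.
have TD p1 p2 : T p1 -> T p2 -> T (p1 + p2).
  rewrite /T glineD derivD => -> ->; rewrite -glineD -big_split.
  by congr (gline u _); apply: eq_bigr => i _; rewrite mderivD scalerDr.
rewrite -/(T p) (mpolyE p); elim/big_ind: _ => //.
  by rewrite -[0]mpolyC0; apply: TC.
move=> m _; rewrite -mul_mpolyC; apply: (TM) => //.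
rewrite mpolyXE_id; elim/big_ind: _ => //; first by rewrite -[1]mpolyC1; apply: TC.
move=> i _; elim: (m i) => [|k IH]; first by rewrite expr0 -mpolyC1; apply: TC.
by rewrite exprS; apply: TM.
Qed.

(** Induction on [m]: a derivative in t is the restriction of a directional derivative of [p], whose
    order of vanishing drops by at most one. In characteristic 0 it determines the coefficients of
    positive index. *)
Lemma line_at_order m p x u :
  (forall k : 'X_{1..n}, (mdeg k < m)%N -> (p^`M[k]).@[x] = 0) ->
  forall j, (j < m)%N -> (line_at u x p)`_j = 0.
Proof.
elim: m p => // m IH p pm [|j] jm.
  rewrite -horner_coef0 horner_line_at.
  have := pm 0%MM; rewrite mdeg0 mderivm0m => /(_ isT) e; rewrite -[RHS]e.
  by apply: meval_eq => i; rewrite mul0r addr0.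
have : (line_at u x p)^`()`_j = 0.
  rewrite deriv_line_at; apply: IH => // k km.
  rewrite raddf_sum raddf_sum big1 // => i _ /=.
  rewrite mderivmZ mevalZ -mderivmU1m -mderivmDm pm ?mulr0 //.
  by rewrite mdegD mdeg1 addnC addn1 ltnS.
by move/eqP; rewrite coef_deriv mulrn_eq0 => /eqP.
Qed.

Lemma line_at_shift u x r p :
  line_at u x p = line_at u (fun i => x i + r * u i) p \Po ('X - r%:P).
Proof.
apply/eqP; rewrite -subr_eq0; apply/eqP/polyfun0 => t.
rewrite hornerD hornerN horner_comp !horner_line_at !hornerE.
apply/eqP; rewrite subr_eq0; apply/eqP/meval_eq => i.
by rewrite -addrA -mulrDl [r + _]addrC subrK.
Qed.

(** Moving the base point to x + r u turns the root [r] into 0, where the order is read off the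
    coefficients. *)
Lemma line_at_root_order m p u x r :
  (forall k : 'X_{1..n}, (mdeg k < m)%N ->
     (p^`M[k]).@[fun i => x i + r * u i] = 0) ->
  ('X - r%:P) ^+ m %| line_at u x p.
Proof.
move=> /line_at_order p0; move: {p0}(p0 u) => p0; rewrite (line_at_shift u x r).
set g := line_at u _ p in p0 *.
have -> : g = drop_poly m g * 'X^m.
  rewrite -[LHS](poly_take_drop m) [take_poly m g](_ : _ = 0) ?add0r //.
  by apply/polyP => j; rewrite coef_take_poly coef0; case: ltnP => // /p0.
by rewrite comp_polyM comp_Xn_poly dvdp_mull.
Qed.

(** If [p] vanishes everywhere, so do its derivatives along the axes, hence all its partial
    derivatives; at the origin these are the coefficients of [p] times nonzero factorials. *)
Lemma mpoly_neq0_eval p : p != 0 -> exists x, p.@[x] != 0.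
Proof.
move=> p0; apply: contrapT => /forallNP E; case/negP: p0; apply/eqP.
pose T p := forall x, p.@[x] = 0.
have Tp : T p by move=> x; apply/eqP/negP => /negP; apply: E.
have TM i q : T q -> T q^`M(i).
  move=> Tq x; pose u := fun j : 'I_n => (j == i)%:R : K.
  have /(congr1 (fun g => g^`().[0])) : line_at u x q = 0.
    by apply: polyfun0 => t; rewrite horner_line_at Tq.
  rewrite deriv_line_at deriv0 horner0 horner_line_at raddf_sum.
  rewrite (bigD1 i) //= big1 ?addr0 => [|j ji].
    rewrite mevalZ /u eqxx mul1r => e; rewrite -[RHS]e.
    by apply: meval_eq => j; rewrite mul0r addr0.
  by rewrite /u mevalZ (negbTE ji) mul0r.
have TMm m q : T q -> T q^`M[m].
  by rewrite mderivm_foldr; elim: flatten => //= i s IH /IH; apply: TM.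
apply/mpolyP => m; rewrite mcoeff0; have := TMm m p Tp (fun=> 0).
rewrite (mpoly_rmorph_ext (g := meval (fun=> 0)) (h := mcoeff 0%MM)) /=; first last.
- by move=> i; rewrite [LHS]mevalXU mcoeffX mnm1_eq0.
- by move=> c; rewrite [LHS]mevalC mcoeffC eqxx mulr1.
rewrite mcoeff_mderivm addm0 => /eqP; rewrite mulrn_eq0 => /orP[|/eqP//].
by rewrite eqn0Ngt prodn_gt0 // => i; rewrite ffactnn fact_gt0.
Qed.
End Lines.

(** * Divisibility of multivariate polynomials *)

Section Division.
Variables (K : numClosedFieldType) (n : nat).
Implicit Types (p q f D : {mpoly K[n]}) (u x : 'I_n -> K).

(** Degree bounds replace exact degrees because [gline u 'X_i] is constant in t when [u i] is 0. *)
Lemma coefM_top (S : nzRingType) (P Q : {poly S}) a b :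
  (size P <= a.+1)%N -> (size Q <= b.+1)%N -> (P * Q)`_(a + b) = P`_a * Q`_b.
Proof.
move=> sP sQ; have ab : (a < (a + b).+1)%N by rewrite ltnS leq_addr.
rewrite coefM (bigD1 (Ordinal ab)) //= big1 ?addr0 ?addKn // => j.
rewrite -val_eqE neq_ltn /= => /orP[ja|aj].
  by rewrite [Q`_ _]nth_default ?mulr0 // (leq_trans sQ) // ltn_subRL ltn_add2r.
by rewrite nth_default ?mul0r // (leq_trans sP).
Qed.

Lemma gline_monomial u m : (size (gline u 'X_[m]) <= (mdeg m).+1)%N /\
  (gline u 'X_[m])`_(mdeg m) = ('X_[m].@[u])%:MP.
Proof.
pose T (e : nat) P (c : K) := (size (P : {poly {mpoly K[n]}}) <= e.+1)%N /\
  P`_e = c%:MP.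
have T1 : T 0%N 1 1 by rewrite /T size_poly1 coef1 mpolyC1.
have TM a b P Q c d : T a P c -> T b Q d -> T (a + b)%N (P * Q) (c * d).
  move=> [sP eP] [sQ eQ]; split; last by rewrite coefM_top // eP eQ mpolyCM.
  apply: leq_trans (size_polyMleq _ _) _; rewrite -subn1 leq_subLR.
  by rewrite add1n -addnS -addSn leq_add.
have TX i : T 1%N (gline u 'X_i) (u i).
  rewrite glineX; split; last by rewrite coefD coefC coefZ coefX mulr1 add0r.
  rewrite -mul_polyC addrC size_MXaddC; case: ifP => // _.
  by rewrite ltnS size_polyC_leq1.
rewrite -/(T (mdeg m) (gline u 'X_[m]) 'X_[m].@[u]) mevalX mdegE mpolyXE_id.
rewrite rmorph_prod /=.
elim/big_rec3: _ => // i c P a _ /(TM _ _ _ _ _ _ _); apply.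
rewrite rmorphXn /=; elim: (m i) => // k IH.
by rewrite !exprS -add1n; apply: TM.
Qed.

(** With d the total degree of [D], the coefficient of t^d is the value at [u] of the top-degree
    form [T] of [D], a constant; any [u] where [T] does not vanish will do. *)
Lemma gline_lead_unit D : D != 0 ->
  exists u, lead_coef (gline u D) \is a GRing.unit.
Proof.
move=> D0; pose d := mdeg (mlead D).
have Dd m : m \in msupp D -> (mdeg m <= d)%N.
  by move=> /msize_mdeg_lt; rewrite -mlead_deg.
pose T := \sum_(m <- msupp D | mdeg m == d) D@_m *: 'X_[m].
have /mpoly_neq0_eval[u Tu] : T != 0.
  apply/eqP => /(congr1 (mcoeff (mlead D))); rewrite mcoeff0 raddf_sum /=.
  rewrite -big_filter (bigD1_seq (mlead D)) ?filter_uniq ?msupp_uniq //=.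
    rewrite big1 => [|m ne]; last by rewrite mcoeffZ mcoeffX (negbTE ne) mulr0.
    rewrite mcoeffZ mcoeffX eqxx mulr1 addr0 => /eqP.
    by rewrite mleadc_eq0 (negbTE D0).
  by rewrite mem_filter eqxx mlead_supp.
exists u.
have gD : gline u D = \sum_(m <- msupp D) (D@_m)%:MP *: gline u 'X_[m].
  rewrite {1}(mpolyE D) raddf_sum; apply: eq_bigr => m _ /=.
  by rewrite -mul_mpolyC glineM glineC mul_polyC.
have sD : (size (gline u D) <= d.+1)%N.
  rewrite gD big_seq; apply: (leq_trans (size_sum _ _ _)).
  apply/bigmax_leqP_seq => m _ mD; apply: leq_trans (size_scale_leq _ _) _.
  by apply: leq_trans (gline_monomial u m).1 _; rewrite ltnS Dd.
have cD : (gline u D)`_d = (T.@[u])%:MP.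
  rewrite gD coef_sum /T [meval u _]raddf_sum raddf_sum [RHS]big_mkcond /=.
  rewrite big_seq [RHS]big_seq.
  apply: eq_bigr => m mD; rewrite coefZ; case: eqP => [<-|/eqP ne].
    by rewrite (gline_monomial u m).2 -mpolyCM mevalZ.
  rewrite nth_default ?mulr0 //; apply: leq_trans (gline_monomial u m).1 _.
  by rewrite ltn_neqAle ne Dd.
have sd : size (gline u D) = d.+1.
  apply/eqP; rewrite eqn_leq sD ltnNge; apply/negP => /leq_sizeP/(_ d (leqnn _)).
  by rewrite cD => /eqP; rewrite mpolyC_eq0 (negbTE Tu).
rewrite /lead_coef sd cD /= unfold_in /= /mpoly_unit.
by rewrite mcoeffC eqxx mulr1 eqxx unitfE.
Qed.
End Division.

(** * Gauss's lemma, and divisibility tested on lines *)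

Section Gauss.
Variable K : numClosedFieldType.

Lemma all_root_scale (P : {poly {poly K}}) s : (forall k, root P`_k s) ->
  exists P', P = ('X - s%:P) *: P'.
Proof.
move=> Ps; exists (\poly_(k < size P) (P`_k %/ ('X - s%:P))).
apply/polyP => k; rewrite coefZ coef_poly; case: ltnP => [_|/(nth_default 0) ->].
  by rewrite mulrC divpK // dvdp_XsubCl.
by rewrite mulr0.
Qed.

(** The linear factors of the scalar in front of [Q] are removed one at a time. At a root s of it,
    [P * S] reduces to 0, so X - s divides all coefficients of [P] or all those of [S], and is
    cancelled there without changing [Q]. *)
Lemma dvdp_coef_of_prod (P S Q : {poly {poly K}}) i j :
  P`_i != 0 -> S`_j != 0 -> P * S = (P`_i * S`_j) *: Q ->
  forall k, P`_i %| P`_k.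
Proof.
have szX (s : K) (c : {poly K}) : ('X - s%:P) * c != 0 ->
    size (('X - s%:P) * c) = (size c).+1.
  move=> /eqP nz; rewrite mulrC size_Mmonic ?monicXsubC //.
    by rewrite size_XsubC addn2.
  by apply/eqP => c0; apply: nz; rewrite c0 mulr0.
have scaleI (c : {poly K}) : c != 0 -> injective (fun A => c *: A : {poly {poly K}}).
  by move=> c0 A B; rewrite -!mul_polyC; apply: mulfI; rewrite polyC_eq0.
move: {2}(_ + _)%N (leqnn (size P`_i + size S`_j)) => N.
elim: N P S Q => [|N IH] P S Q leN Pi Sj ePS k.
  by move: leN; rewrite leqn0 addn_eq0 size_poly_eq0 (negbTE Pi).
have [/closed_rootP[s rs]|] := boolP (size (P`_i * S`_j) != 1%N); last first.
  rewrite negbK size_mul_eq1.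
  by case/andP; rewrite size_poly_eq1 => /eqp_dvdl -> _; apply: dvd1p.
have Xs0 : ('X - s%:P : {poly K}) != 0 by rewrite polyXsubC_eq0.
have /eqP : map_poly (horner_eval s) P * map_poly (horner_eval s) S = 0.
  rewrite -rmorphM ePS /= map_polyZ /=.
  by move/rootP: rs; rewrite /horner_eval => ->; rewrite scale0r.
rewrite mulf_eq0 => /orP[]/eqP Z.
- have [k'|P' eP] := @all_root_scale P s.
    by apply/rootP; move/polyP: Z => /(_ k'); rewrite coef_map coef0.
  move: leN Pi ePS; rewrite eP !coefZ => leN Pi.
  rewrite -scalerAl -mulrA -scalerA => /(scaleI _ Xs0) eP'S.
  rewrite dvdp_mul2l //; apply: (IH _ S Q) => //.
    by move: leN; rewrite szX.
  by apply: contraNneq Pi => ->; rewrite mulr0.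
- have [k'|S' eS] := @all_root_scale S s.
    by apply/rootP; move/polyP: Z => /(_ k'); rewrite coef_map coef0.
  move: leN Sj ePS; rewrite eS !coefZ => leN Sj.
  rewrite -scalerAr mulrCA -scalerA => /(scaleI _ Xs0) ePS'.
  apply: (IH _ S' Q) => //.
    by move: leN; rewrite szX // addnS.
  by apply: contraNneq Sj => ->; rewrite mulr0.
Qed.

(** [g] splits into distinct linear factors, whose powers are pairwise coprime. *)
Lemma separable_exp_dvd (g h : {poly K}) m : separable_poly g ->
  (forall r, root g r -> ('X - r%:P) ^+ m %| h) -> g ^+ m %| h.
Proof.
move=> sg H; have g0 := separable_poly_neq0 sg.
have [rs eg] := closed_field_poly_normal g.
have eqg : g %= \prod_(z <- rs) ('X - z%:P).
  by rewrite {1}eg eqp_scale // lead_coef_eq0.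
have urs : uniq rs by rewrite -separable_prod_XsubC -(eqp_separable eqg).
have {}H r : r \in rs -> ('X - r%:P) ^+ m %| h.
  by move=> rr; apply: H; rewrite (eqp_root eqg) root_prod_XsubC.
rewrite (eqp_dvdl _ (eqp_exp m eqg)) -prodrXl.
elim: rs urs H {eg eqg} => [|r rs IH] /=; first by rewrite big_nil dvd1p.
case/andP=> rrs urs H; rewrite big_cons Gauss_dvdp; last first.
  rewrite prodrXl; apply/coprimep_expl/coprimep_expr.
  by rewrite coprimep_sym coprimep_XsubC root_prod_XsubC.
by rewrite H ?mem_head // IH // => z zrs; rewrite H // in_cons zrs orbT.
Qed.

Variable n : nat.
Implicit Types (p q f D e : {mpoly K[n]}) (u x : 'I_n -> K).

(** A unit leading coefficient allows Euclidean division in t over K[x]. A nonzero remainder would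
    keep its degree at some x where [e] is nonzero, and be divisible there by a polynomial of larger
    degree. *)
Lemma gline_dvd u D a e : lead_coef (gline u D) \is a GRing.unit -> e != 0 ->
  (forall x, e.@[x] != 0 -> line_at u x D %| line_at u x a) -> pdvd D a.
Proof.
move=> lU e0 H; have ea := Pdiv.IdomainUnit.divp_eq lU (gline u a).
set s := _ %/ _ in ea; set r := _ %% _ in ea.
have D0 : gline u D != 0.
  by rewrite -lead_coef_eq0; apply: contraTneq lU => ->; rewrite unitr0.
have [r0|r0] := eqVneq r 0.
  exists s.[0]; rewrite -[LHS](gline_at0 u) ea r0 addr0 hornerM.
  by rewrite gline_at0.
have [|x] := @mpoly_neq0_eval _ _ (lead_coef r * e).
  by rewrite mulf_neq0 // lead_coef_eq0.
rewrite mevalM mulf_eq0 negb_or => /andP[rx /H].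
have lx : (lead_coef (gline u D)).@[x] != 0 by rewrite -unitfE rmorph_unit.
rewrite /line_at ea rmorphD rmorphM /= dvdp_addr ?dvdp_mull // => /dvdp_leq.
rewrite -lead_coef_eq0 (@lead_coef_map_id0 _ _ (meval x)) ?raddf0 // => /(_ rx).
rewrite !size_map_poly_id0 // leqNgt => /negP[].
by rewrite /r Pdiv.CommonIdomain.ltn_modp.
Qed.

(* Gauss's lemma: P is, up to a scalar, a factor of the monic polynomial Q over
   the fraction field. *)
Lemma lead_coef_dvd (P S Q : {poly {mpoly K[n]}}) : P != 0 -> S != 0 ->
  P * S = (lead_coef P * lead_coef S) *: Q ->
  exists2 P0, P0 \is monic & P = lead_coef P *: P0.
Proof.
move=> P0 S0 ePS; have lP : lead_coef P != 0 by rewrite lead_coef_eq0.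
have [u lu] := gline_lead_unit lP.
have /choice[r er] k : pdvd (lead_coef P) P`_k.
  apply: (gline_dvd (e := lead_coef P * lead_coef S) lu).
    by rewrite mulf_neq0 // lead_coef_eq0.
  (* On the line through x the coefficients become one-variable polynomials, and both leading ones
     stay nonzero. *)
  move=> x; rewrite mevalM mulf_eq0 negb_or => /andP[Px Sx].
  have nz p : p.@[x] != 0 -> line_at u x p != 0.
    apply: contraNneq => z; have := horner_line_at u x p 0; rewrite z horner0.
    move=> e1; apply/eqP; rewrite [RHS]e1; apply/meval_eq => i.
    by rewrite mul0r addr0.
  move: ePS => /(congr1 (map_poly (line_at u x))).
  rewrite rmorphM map_polyZ rmorphM /= => ePS.
  have := @dvdp_coef_of_prod (map_poly (line_at u x) P)
    (map_poly (line_at u x) S) (map_poly (line_at u x) Q)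
    (size P).-1 (size S).-1.
  by rewrite !coef_map /= => /(_ (nz _ Px) (nz _ Sx) ePS k); rewrite coef_map.
pose P1 := \poly_(k < size P) r k.
have eP : P = lead_coef P *: P1.
  apply/polyP => k; rewrite coefZ coef_poly; case: ltnP => [_|kP].
    by rewrite mulrC -er.
  by rewrite mulr0 nth_default.
exists P1 => //; apply/monicP; apply: (mulfI lP).
by rewrite -lead_coefZ -eP mulr1.
Qed.
End Gauss.

(** * Squarefree polynomials on general lines *)

Section SquareFree.
Variables (K : numClosedFieldType) (n : nat).
Implicit Types (p q f D e : {mpoly K[n]}) (u x : 'I_n -> K).

(** Setting t = l and translating x by -l u undoes the substitution, so a factorization of
    [gline u p] descends to one of [p]. *)
Lemma gline_horner_shift u p (l : K) :
  comp_mpoly [tuple 'X_i - (l * u i)%:MP | i < n] (gline u p).[l%:MP] = p.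
Proof.
pose c := comp_mpoly [tuple ('X_i : {mpoly K[n]}) - (l * u i)%:MP | i < n].
rewrite -[LHS]/((c \o horner_eval l%:MP \o gline u) p) -[RHS]/(idfun p).
apply: mpoly_rmorph_ext => [a|i]; rewrite /= /horner_eval /c.
  by rewrite glineC hornerC comp_mpolyC.
rewrite glineX !hornerE rmorphD rmorphM /= !comp_mpolyC comp_mpolyXU.
by rewrite -tnth_nth tnth_mktuple -mpolyCM mulrC subrK.
Qed.

(** By Gauss's lemma, a square factor of [gline u q] over the fraction field yields the square of a
    monic factor over K[x], which a suitable value of t carries to a square factor of [q]. *)
Lemma squarefree_separable u q : squarefree q ->
  lead_coef (gline u q) \is a GRing.unit -> separable_poly (gline u q).
Proof.
move=> [q0 sq] lU; apply/separable_polyP; split=> [|P _ sP]; last first.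
  apply/eqP => /polyP/(_ (size P).-2); rewrite coef_deriv coef0.
  rewrite -[_.-2.+1]/(_.-1.-1.+1) prednK; last by rewrite -ltnS prednK // ltnW.
  move=> /eqP; rewrite -scaler_nat mscalerI pnatr_eq0 -/(lead_coef P).
  by rewrite lead_coef_eq0 -size_poly_eq0; case: (size P) sP => [|[]].
apply/poly_square_freeP => P sP; apply/negP.
have lQ0 : lead_coef (gline u q) != 0.
  by apply: contraTneq lU => ->; rewrite unitr0.
(* Divisibility over a domain holds only up to a nonzero scalar [c]. *)
case/Pdiv.Idomain.dvdpP => -[/= c S1] c0 eS1.
have nz : c *: gline u q != 0.
  by rewrite -mul_polyC mulf_neq0 ?polyC_eq0 // -lead_coef_eq0.
have eS : P * (S1 * P) = (lead_coef P * lead_coef (S1 * P)) *: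
    ((lead_coef (gline u q))^-1 *: gline u q).
  rewrite -lead_coefM; have -> : P * (S1 * P) = c *: gline u q.
    by rewrite eS1 mulrCA -expr2.
  by rewrite lead_coefZ scalerA mulrK.
have := nz; rewrite eS1 mulf_eq0 expf_eq0 /= negb_or => /andP[S10 P0].
have [P1 mP1 eP] := lead_coef_dvd P0 (mulf_neq0 S10 P0) eS.
have sP1 : size P1 = size P by rewrite eP size_scale // lead_coef_eq0.
have [S2 eq] : exists S2, gline u q = S2 * P1 ^+ 2.
  apply/Pdiv.IdomainMonic.dvdpP; first exact: monic_exp.
  rewrite -(@dvdpZr _ c) // eS1 dvdp_mull // eP exprZn.
  by rewrite dvdpZr // expf_neq0 // lead_coef_eq0.
(* With [l] a root of [P1] at x = 0, the descended factor vanishes at the point l u; squarefreeness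
   makes it constant, hence zero, and then [q] is zero. *)
have [l rl] : exists l, root (map_poly (meval (fun=> 0)) P1) l.
  apply/closed_rootP; rewrite size_map_poly_id0 ?sP1 //.
  by rewrite (monicP mP1) rmorph1 oner_neq0.
pose sh := comp_mpoly [tuple ('X_i : {mpoly K[n]}) - (l * u i)%:MP | i < n].
have eqq : q = sh S2.[l%:MP] * sh P1.[l%:MP] ^+ 2.
  by rewrite -rmorphXn -rmorphM -[LHS](gline_horner_shift u _ l) eq !hornerE.
have [|k ek] := sq (sh P1.[l%:MP]); first by exists (sh S2.[l%:MP]).
have k0 : k = 0.
  rewrite -(mevalC (fun i => l * u i) k) -ek comp_mpoly_meval.
  move/rootP: rl; rewrite -{1}(mevalC (fun _ : 'I_n => 0) l) horner_map => rl.
  rewrite -[RHS]rl; apply: meval_eq => i; rewrite tnth_mktuple.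
  by rewrite mevalB mevalXU mevalC subrr.
by apply: q0; rewrite eqq ek k0 mpolyC0 expr0n mulr0.
Qed.

Lemma squarefree_exp_dvd q f m : squarefree q ->
  (forall x u r, q.@[fun i => x i + r * u i] = 0 ->
     ('X - r%:P) ^+ m %| line_at u x f) -> pdvd (q ^+ m) f.
Proof.
move=> sq H; have /eqP/gline_lead_unit[u lU] := sq.1.
have := squarefree_separable sq lU; rewrite separable_poly.unlock.
case/Bezout_coprimepP => -[A B] /=.
(* The Bezout combination of the restriction and its derivative is a polynomial [e] free of t. Like
   a discriminant, it ensures simple roots on the line through x wherever it is nonzero. *)
set Z := _ + _ => eZ; have := eZ; rewrite -size_poly_eq1 => /size_poly1P[e e0 eZe].
apply: (gline_dvd (u := u) (e := e)) => // [|x ex].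
  by rewrite rmorphXn lead_coef_exp unitrX.
rewrite rmorphXn; apply: separable_exp_dvd => [|r].
  rewrite separable_poly.unlock; apply/Bezout_coprimepP.
  exists (map_poly (meval x) A, map_poly (meval x) B) => /=.
  rewrite /line_at deriv_map -!rmorphM -rmorphD /= -/Z eZe map_polyC.
  by rewrite -size_poly_eq1 size_polyC ex.
by rewrite /root horner_line_at => /eqP; apply: H.
Qed.
End SquareFree.

(** * Dual varieties *)

Local Open Scope classical_set_scope.

Section Homogeneous.
Variable K : numClosedFieldType.

(** If [mdeg k] exceeds [d], the subtraction truncates to 0, but the derivative is then zero, which
    is homogeneous of every degree. *)
Lemma dhomog_mderivm n d (p : {mpoly K[n]}) k :
  p \is d.-homog -> p^`M[k] \is (d - mdeg k).-homog.
Proof.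
move=> /dhomogP hp; apply/dhomogP => m.
rewrite mcoeff_msupp mcoeff_mderivm => nz; apply/eqP.
have /hp : (k + m)%MM \in msupp p.
  by rewrite mcoeff_msupp; apply: contraNneq nz => ->; rewrite mul0rn.
by move=> <-; rewrite /= mdegD addKn.
Qed.

Lemma dhomog_meval n d (p : {mpoly K[n]}) c (x : 'I_n -> K) :
  p \is d.-homog -> p.@[fun i => c * x i] = c ^+ d * p.@[x].
Proof.
move=> /dhomogP hp; rewrite !mevalE mulr_sumr !big_seq.
apply: eq_bigr => m /hp /= <-; rewrite mulrCA mdegE; congr (_ * _).
rewrite (eq_bigr (fun i => c ^+ m i * x i ^+ m i)) => [|i _].
  by rewrite big_split /= prodrXr.
exact: exprMn.
Qed.

Lemma dhomog_comp_mpoly n k d (p : {mpoly K[n]}) (lq : n.-tuple {mpoly K[k]}) :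
  p \is d.-homog -> (forall i, tnth lq i \is 1.-homog) ->
  p \mPo lq \is d.-homog.
Proof.
move=> /dhomogP hp hlq; rewrite comp_mpolyEX big_seq rpred_sum // => m /hp /= <-.
apply: rpredZ; rewrite comp_mpolyX mdegE.
elim/big_rec2: _ => [|i y P _ hP]; first exact: dhomog1.
apply: dhomogM => //; elim: (m i) => [|e he]; first exact: dhomog1.
by rewrite exprS -add1n dhomogM.
Qed.

Variables U W : vectType K.
Implicit Types (f : 'Hom(U, W)) (p : polyOn K W) (w v : W).

Lemma dhomog_pullback f p d :
  p \is d.-homog -> pullback f p \is d.-homog.
Proof.
move=> hp; apply: dhomog_comp_mpoly hp _ => i; rewrite tnth_mktuple.
by apply: rpred_sum => j _; apply: rpredZ; rewrite dhomogX /= mdeg1.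
Qed.

Lemma peval_dhomog p d c w : p \is d.-homog -> peval p (c *: w) = c ^+ d * peval p w.
Proof.
by move=> hp; rewrite -(dhomog_meval _ _ hp); apply: meval_eq => i; apply: linearZ.
Qed.

Lemma crd_surj (a : 'I_(\dim {:W}) -> K) : exists w, crd w =1 a.
Proof.
exists (\sum_i a i *: (vbasis {:W})`_i) => i.
by rewrite /crd coord_sum_free // (basis_free (vbasisP _)).
Qed.

Lemma horner_line_crd p w v t :
  (line_at (crd v) (crd w) p).[t] = peval p (w + t *: v).
Proof.
rewrite horner_line_at; apply: meval_eq => i.
by rewrite /crd linearD linearZ.
Qed.
End Homogeneous.

(** * Closed sets and their linear preimages *)

Section Closed.
Variable K : numClosedFieldType.

Lemma zclosed_zero_locus1 (W : vectType K) (p : polyOn K W) :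
  homogeneous p -> zclosed (zero_locus [set p]).
Proof. by move=> hp; exists [set p] => // _ ->. Qed.

Lemma zclosure_zero_locus1 (W : vectType K) (p : polyOn K W) (S : set (proj W)) :
  homogeneous p -> S `<=` zero_locus [set p] ->
  zclosure S `<=` zero_locus [set p].
Proof. by move=> hp; apply: smallest_sub; apply: zclosed_zero_locus1. Qed.

Lemma zclosed_pullback (U W : vectType K) (f : 'Hom(U, W)) (F : set (polyOn K W)) :
  (forall p, F p -> homogeneous p) ->
  zclosed (zero_locus [set pullback f p | p in F]).
Proof.
move=> hF; eexists; last reflexivity.
by move=> _ [p /hF[d hp] <-]; exists d; apply: dhomog_pullback.
Qed.

Lemma zero_locus_pullback (U W : vectType K) (f : 'Hom(U, W))
    (F : set (polyOn K W)) l l' : line l' = (f @: line l)%VS ->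
  zero_locus [set pullback f p | p in F] l <-> zero_locus F l'.
Proof.
move=> el'; split=> H => [p Fp w|_ [p Fp <-] w wl].
  rewrite el' => /memv_imgP[u ul ->]; rewrite -peval_pullback.
  by apply: (H _ _ u ul); exists p.
by rewrite peval_pullback; apply: (H _ Fp); rewrite el' memv_img.
Qed.

Lemma proj_of_vector (W : vectType K) (w : W) : w != 0 ->
  exists l : proj W, w \in line l /\
    forall v, v \in line l -> exists c, v = c *: w.
Proof.
move=> w0; have d : \dim <[w]> == 1%N by rewrite dim_vline w0.
exists (exist (fun L : {vspace W} => \dim L == 1%N) _ d).
by split=> [|v /vlineP//]; apply: memv_line.
Qed.

Lemma proj_nonzero (W : vectType K) (l : proj W) :
  exists2 w, w \in line l & w != 0.
Proof.
exists (vpick (line l)); first exact: memv_pick.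
by rewrite vpick0 -dimv_eq0; case: l => l /= /eqP ->.
Qed.

End Closed.

(** * Inclusion of the dual varieties, and vanishing of derivatives *)

Section Duals.
Variables (K : numClosedFieldType) (V : vectType K) (A B : {vspace V}).
Hypothesis dirAB : (A :&: B = 0)%VS.

Lemma dual_variety_subset (X : set (proj V)) (Y : set (proj (subvs_of A))) :
  (forall y, smooth_point Y y ->
     exists2 x, smooth_point X x &
       proj_along A B @` tangent X x `<=` tangent Y y) ->
  proj_image (dual_ext A B) (dual_variety Y) `<=` dual_variety X.
Proof.
move=> tXY H' [H YH eH'] C [[F hF ->] SC].
(* The preimage of an arbitrary closed set [C] containing the tangent hyperplanes of [X] is closed,
   so it need only contain those of [Y]. *)
apply/(zero_locus_pullback F eH'); apply: YH; split; first exact: zclosed_pullback.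
move=> {H' H eH'} H [y sy yH]; have [x sx xy] := tXY _ sy.
have [H' [_ -> eH']] := proj_image_dual_ext dirAB H.
apply/(zero_locus_pullback F eH'); apply: SC; exists x => // h.
rewrite eH' => /memv_imgP[g gH ->] v vx; rewrite dual_extE comp_lfunE.
by apply: (yH g gH); apply: xy; exists v.
Qed.

Lemma vanishing_of_general_multiplicity (Z : set (proj (dual (subvs_of A))))
    (p : polyOn K (dual V)) m d k :
  p \is d.-homog -> (mdeg k < m)%N ->
  general_point Z (fun h => forall H,
    proj_image (dual_ext A B) [set h] H -> multiplicity p H m) ->
  Z `<=` zero_locus [set pullback (dual_ext A B) p^`M[k]].
Proof.
move=> hp km [U [_ ZU mU]] l /ZU; apply: zclosure_zero_locus1.
  by eexists; apply/dhomog_pullback/dhomog_mderivm; exact: hp.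
move=> {}l lU _ -> .
set g := pullback _ _.
have [d' hg] : homogeneous g.
  by eexists; apply/dhomog_pullback/dhomog_mderivm; exact: hp.
have g0 w : w \in line l -> w != 0 -> peval g w = 0.
  move=> wl w0; rewrite peval_pullback.
  have [H iH] := proj_image_dual_ext dirAB l; have [_ -> eH] := iH.
  have [||kp _] := mU _ lU H iH (dual_ext A B w); last exact: kp.
    by rewrite eH memv_img.
  apply: contraNneq w0 => /eqP; rewrite -memv_ker dual_ext_inj //.
  by rewrite memv0.
(* A zero locus also tests the zero vector; writing it as 0 times a nonzero [v] of the line, where
   [g] vanishes, covers degree 0 too. *)
move=> w wl; have [w0|] := eqVneq w 0; last exact: g0.
have [v vl v0] := proj_nonzero l.
by rewrite w0 -(scale0r v) (peval_dhomog _ _ hg) g0 // mulr0.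
Qed.
End Duals.

Theorem theorem2p2 (R : realType) (V : vectType R[i]) (A B : {vspace V})
    (X : set (proj V)) (Y : set (proj (subvs_of A))) :
  (A + B = fullv)%VS -> (A :&: B = 0)%VS -> A <> 0%VS -> B <> 0%VS ->
  zclosed X -> zclosed Y ->
  (forall y, smooth_point Y y ->
     exists2 x, smooth_point X x &
       proj_along A B @` tangent X x `<=` tangent Y y) ->
  (proj_image (dual_ext A B) (dual_variety Y)
     `<=` dual_variety X `&` PAdual A B) /\
  (forall (DeltaX : polyOn R[i] (dual V))
          (DeltaY : polyOn R[i] (dual (subvs_of A))) (m : nat),
     hypersurface_eq (dual_variety X) DeltaX ->
     hypersurface_eq (dual_variety Y) DeltaY ->
     general_point (dual_variety Y)
       (fun h => forall H, proj_image (dual_ext A B) [set h] H ->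
                   multiplicity DeltaX H m) ->
     pdvd (DeltaY ^+ m) (Res A B DeltaX)).
Proof.
move=> _ dirAB _ _ _ _ tXY; split=> [H' H'Y|DX DY m hX hY gY].
  split; first exact: (dual_variety_subset dirAB tXY).
  by case: H'Y => H _ eH; exists H.
have [[l0 Zl0] sqY [dY _ homY] eY] := hY; have [_ _ [dX _ homX] _] := hX.
apply: squarefree_exp_dvd => // x u r.
have [w ew] := crd_surj x; have [v ev] := crd_surj u => q0.
have {q0} qw : peval DY (w + r *: v) = 0.
  rewrite -[RHS]q0; apply: meval_eq => i.
  by rewrite -ew -ev /crd linearD linearZ.
have DX0 k : (mdeg k < m)%N -> peval DX^`M[k] (dual_ext A B (w + r *: v)) = 0.
  move=> km; have ZX := vanishing_of_general_multiplicity dirAB homX km gY.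
  rewrite -peval_pullback; set z := w + _ in qw *.
  (* The zero vector spans no projective point, but it lies on the line of the point [l0] of the
     nonempty dual variety of [Y]. *)
  have [->|z0] := eqVneq z 0; first exact: (ZX _ Zl0 _ erefl _ (mem0v _)).
  have [l [zl lz]] := proj_of_vector z0; apply: (ZX l _ _ erefl z zl).
  rewrite eY => _ -> _ /lz[c ->].
  by rewrite (peval_dhomog _ _ homY) qw mulr0.
(* The bases chosen on the two dual spaces are unrelated, so the restrictions are compared through
   their values at every t. *)
have -> : line_at u x (Res A B DX) =
    line_at (crd (dual_ext A B v)) (crd (dual_ext A B w)) DX.
  apply/eqP; rewrite -subr_eq0; apply/eqP/polyfun0 => t.
  rewrite hornerD hornerN horner_line_crd -linearZ -linearD -peval_pullback.
  rewrite horner_line_at; apply/eqP; rewrite subr_eq0; apply/eqP.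
  by apply: meval_eq => i; rewrite -ew -ev /crd linearD linearZ.
apply: line_at_root_order => k /DX0 {DX0}DX0; rewrite -[RHS]DX0.
by apply: meval_eq => i; rewrite /crd !linearD !linearZ.
Qed.
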